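(* Let $k\ge 1$ and let $G=(V,E)$ be a $k$-connected undirected graph on $n$ nodes. Then there exists a data structure of size $O(kn)$ that stores a list of $O(n)$ cuts of $G$ and answers each of the following queries, for any given pair $s,t\in V$, in $O(1)$ time: (con) determine whether $\kappa(s,t)\ge k+1$; (cut) if $\kappa(s,t)\le k$, return a pointer to an $st$-cut of size at most $k$ that belongs to the stored list.
   Context: For distinct nodes $s,t$ of an undirected graph $G=(V,E)$, $\kappa(s,t)=\kappa_G(s,t)$ denotes the maximum number of internally disjoint $st$-paths in $G$. An $st$-cut is a subset $C\subseteq V\cup E$ (not containing $s,t$) such that $G\setminus C$ has no $st$-path; by Menger's theorem $\kappa(s,t)$ equals the minimum size of an $st$-cut. $G$ is $k$-connected if $\kappa(s,t)\ge k$ for all distinct $s,t\in V$. Space is measured in machine words (node indices count as one word each, i.e. the $O(\log n)$ factor for storing indices is ignored). *)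

(* Defs.v *)
From mathcomp Require Import all_boot.

Set Implicit Arguments.
Unset Strict Implicit.
Unset Printing Implicit Defensive.

(* A finite simple graph is a symmetric irreflexive relation e on a finType. *)
Section Connectivity.

Variables (V : finType) (e : rel V).
Implicit Types (s t : V) (p q : seq V).

(* The st-path s :: p; the head s is kept apart, as in path.v. *)
Definition st_path s t p := [&& path e s p, last s p == t & uniq (s :: p)].

Definition inner t p := [seq x <- p | x != t].

Definition internally_disjoint t p q := ~~ has (mem (inner t p)) (inner t q).

(* Paths have at most #|V| nodes, so that bounded sequences cover them all.
   Elements of a set are distinct: the path formed by an edge st, which has
   no inner node, counts once. *)
Definition disjoint_st_paths s t (P : {set {bseq #|V| of V}}) :=
  [forall p in P, st_path s t p]
  && [forall p in P, forall q in P, (p != q) ==> internally_disjoint t p q].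

Definition kappa s t : nat :=
  \max_(P : {set {bseq #|V| of V}} | disjoint_st_paths s t P) #|P|.

Definition k_connected (k : nat) := forall s t, s != t -> k <= kappa s t.

Definition edges : {set {set V}} :=
  [set f | [exists x, exists y, e x y && (f == [set x; y])]].

(* A subset of the union of nodes (inl) and edges (inr). *)
Definition mixed := {set (V + {set V})%type}.

Definition delete (C : mixed) : rel V := fun x y =>
  [&& e x y, inl x \notin C, inl y \notin C & inr [set x; y] \notin C].

Definition st_cut s t (C : mixed) :=
  [&& [forall f, (inr f \in C) ==> (f \in edges)],
      inl s \notin C, inl t \notin C & ~~ connect (delete C) s t].

Definition cut (C : mixed) := exists s t, s != t /\ st_cut s t C.

End Connectivity.

(* A random access machine with constantly many registers and a read-only
   memory, given as a sequence of words. Below, r, a and b are registers, c is a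
   constant and l a program line. There is no shift or exponentiation, so a run of O(1) steps on words polynomial in n only
   produces values polynomial in n, that is, of O(log n) bits. *)
Inductive arith := Add | Sub | Mul | Div | Mod.

Inductive instr :=
  | Const of nat & nat          (* r c   : r := c *)
  | Arith of arith & nat & nat & nat (* o r a b : r := a o b *)
  | Read of nat & nat           (* r a   : r := memory[a] *)
  | JumpLt of nat & nat & nat   (* a b l : if a < b goto l *)
  | Halt of nat.                (* a     : return a *)

Definition program := seq instr.

Definition arith_fun (o : arith) : nat -> nat -> nat :=
  match o with
  | Add => addn | Sub => subn | Mul => muln | Div => divn | Mod => modn
  end.

Definition upd (R : nat -> nat) (r v : nat) : nat -> nat :=
  fun i => if i == r then v else R i.

(* Every instruction, Halt included, costs one unit of fuel; None means that
   the fuel is exhausted. *)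
Fixpoint exec (P : program) (M : seq nat) (fuel pc : nat) (R : nat -> nat)
    : option nat :=
  if fuel is m.+1 then
    match nth (Halt 0) P pc with
    | Const r c => exec P M m pc.+1 (upd R r c)
    | Arith o r a b => exec P M m pc.+1 (upd R r (arith_fun o (R a) (R b)))
    | Read r a => exec P M m pc.+1 (upd R r (nth 0 M (R a)))
    | JumpLt a b l => exec P M m (if R a < R b then l else pc.+1) R
    | Halt a => Some (R a)
    end
  else None.

Section Query.

Variable V : finType.

(* The index of a node is its rank in the enumeration of V. The two arguments
   of a query are in registers 0 and 1, and all other registers hold 0. *)
Definition returns (P : program) (M : seq nat) (time : nat) (s t : V)
    (out : nat) :=
  exec P M time 0 (nth 0 [:: val (enum_rank s); val (enum_rank t)]) = Some out.

(* A stored pair of indices stands for an edge, or for a node if they agree. *)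
Definition decode (a : V * V) : V + {set V} :=
  if a.1 == a.2 then inl a.1 else inr [set a.1; a.2].

(* Address p holds the size of C, followed by the pairs coding its elements. *)
Definition stored_at (M : seq nat) (p : nat) (C : mixed V) :=
  exists l : seq (V * V),
    [/\ size l = #|C|, C = [set decode a | a in l]
      & prefix (size l :: flatten [seq [:: val (enum_rank a.1);
                                           val (enum_rank a.2)] | a <- l])
               (drop p M)].

End Query.

(* The memory M, with the list L of the cuts it stores, each of them given with
   its address, answers both queries in the given time. *)
Definition cut_oracle (V : finType) (e : rel V) (k : nat)
    (Pcon Pcut : program) (time : nat)
    (M : seq nat) (L : seq (nat * mixed V)) :=
  (forall a, a \in L -> cut e a.2 /\ stored_at M a.1 a.2) /\
  (forall s t : V, s != t ->
     (exists2 b, returns Pcon M time s t b & b <> 0 <-> k.+1 <= kappa e s t) /\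
     (exists2 p, returns Pcut M time s t p &
        kappa e s t <= k ->
        exists C, [/\ (p, C) \in L, st_cut e s t C & #|C| <= k])).

(* Main.v *)
Require Import Defs.
From mathcomp Require Import all_boot.
From mathcomp Require Import zify.

(* Write f(A, B) for the number of nodes outside of the disjoint sets A and B plus
   the number of edges between them; f is submodular under
   (A, B), (A', B') |-> (A :&: A', B :|: B'), (A :|: A', B :&: B'), and f >= k
   on nonempty sets if the graph is k-connected. By uncrossing, among the pairs
   with s in A, f(A, B) = k and 2 #|A| <= n - k + 1 there is a least one,
   (A_s, B_s), with smallest A and largest B. Menger's theorem provides a cut
   that contains no edge besides st, so that one of its two sides is that small:
   kappa(s, t) <= k iff t is in B_s or s is in B_t. Thus n cuts suffice, and it
   remains to decide in O(1) time whether t lies in A_s, or in the set U_s of the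
   at most k nodes outside of A_s and B_s.
   - A_s and A_t are nested or disjoint unless s is in U_t or t is in U_s. This
     conflict graph has a colouring with 2k + 1 colours; for each colour, the
     sets A_s are laminar, hence intervals of one linear order of the nodes.
   - The sets U_s are kept in one sparse table: a function h from the nodes to k
     buckets, common to all s, has O(kn) collisions inside the sets U_s, and the
     rows {t in U_s | h t = b} are then overlaid by first fit displacement. *)

Set Implicit Arguments.
Unset Strict Implicit.
Unset Printing Implicit Defensive.

(** * Straight-line programs *)

(** Neither query needs a jump: each is one expression over the memory, so that its running time is
    the length of its code. *)
Inductive expr :=
  | Arg of bool
  | Cst of nat
  | Op of arith & expr & expr
  | Mem of expr.

Fixpoint eval (M : seq nat) (x y : nat) (a : expr) : nat :=
  match a with
  | Arg b => if b then y else x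
  | Cst c => c
  | Op o a1 a2 => arith_fun o (eval M x y a1) (eval M x y a2)
  | Mem a1 => nth 0 M (eval M x y a1)
  end.

(** The value ends up in register [r], and only registers from [r] on are overwritten. In [Arg b]
    the boolean is itself the register number, and adding to 0 copies a register. *)
Fixpoint compile (a : expr) (r : nat) : program :=
  match a with
  | Arg b => [:: Const r 0; Arith Add r r b]
  | Cst c => [:: Const r c]
  | Op o a1 a2 => compile a1 r ++ compile a2 r.+1 ++ [:: Arith o r r r.+1]
  | Mem a1 => compile a1 r ++ [:: Read r r]
  end.

Definition program_of (a : expr) : program := rcons (compile a 2) (Halt 2).

(** The context [pre], [post] lets the induction run pieces of a larger program. Preserving the
    registers below [r] protects the arguments, and the left operand while the right one is
    computed. *)
Lemma exec_compile M a r pre post fuel (R : nat -> nat) : 1 < r ->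
  exists R' : nat -> nat,
    [/\ exec (pre ++ compile a r ++ post) M (size (compile a r) + fuel)
          (size pre) R
        = exec (pre ++ compile a r ++ post) M fuel
            (size pre + size (compile a r)) R',
        R' r = eval M (R 0) (R 1) a & forall i, i < r -> R' i = R i].
Proof.
have step P N pc m (Q : nat -> nat) i : nth (Halt 0) P pc = i ->
    exec P N m.+1 pc Q = match i with
    | Const r c => exec P N m pc.+1 (upd Q r c)
    | Arith o r a b => exec P N m pc.+1 (upd Q r (arith_fun o (Q a) (Q b)))
    | Read r a => exec P N m pc.+1 (upd Q r (nth 0 N (Q a)))
    | JumpLt a b l => exec P N m (if Q a < Q b then l else pc.+1) Q
    | Halt a => Some (Q a)
    end by move=> <-.
elim: a r pre post fuel R => [b|c|o a1 IH1 a2 IH2|a1 IH1] r pre post fuel R r1.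
- exists (upd (upd R r 0) r (R b)); split.
  + rewrite [size (compile _ _) + _]/= (step _ _ _ _ _ (Const r 0)); last first.
      by rewrite nth_cat ltnn subnn.
    rewrite (step _ _ _ _ _ (Arith Add r r b)); last first.
      by rewrite nth_cat ltnNge leqnSn /= subSn // subnn.
    rewrite /= addn2 /upd eqxx add0n; congr exec.
    by case: b => /=; case: eqP => // E; rewrite -E in r1.
  + by rewrite /upd eqxx /=; case: b.
  + by move=> i ir; rewrite /upd; case: eqP => // E; rewrite E ltnn in ir.
- exists (upd R r c); split.
  + rewrite (step _ _ _ _ _ (Const r c)) ?addn1 //.
    by rewrite nth_cat ltnn subnn.
  + by rewrite /upd eqxx.
  + by move=> i ir; rewrite /upd; case: eqP => // E; rewrite E ltnn in ir.
- set c1 := compile a1 r; set c2 := compile a2 r.+1.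
  set i3 := Arith o r r r.+1.
  have [R1 [E1 V1 F1]] :=
    IH1 r pre (c2 ++ [:: i3] ++ post) (size c2 + fuel.+1) R r1.
  have [R2 [E2 V2 F2]] :=
    IH2 r.+1 (pre ++ c1) ([:: i3] ++ post) fuel.+1 R1 (ltnW r1).
  exists (upd R2 r (arith_fun o (R2 r) (R2 r.+1))); split.
  + rewrite /= -/c1 -/c2 -/i3 !size_cat /= -!catA.
    rewrite (_ : size c1 + _ + fuel = size c1 + (size c2 + fuel.+1)); last lia.
    rewrite E1 -/c1 -size_cat; rewrite -!catA in E2; rewrite E2 -/c2.
    rewrite (step _ _ _ _ _ i3) /i3.
      by congr exec; rewrite size_cat; lia.
    rewrite 2!catA nth_cat !size_cat ltnn.
    by rewrite (_ : _ - _ = 0) //; lia.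
  + by rewrite /upd eqxx V2 F2 // V1 !F1 // ltnW.
  + move=> i ir; rewrite /upd; case: eqP => [E|_]; first by rewrite E ltnn in ir.
    by rewrite F2 ?F1 // ltnW.
- set c1 := compile a1 r.
  have [R1 [E1 V1 F1]] := IH1 r pre ([:: Read r r] ++ post) fuel.+1 R r1.
  exists (upd R1 r (nth 0 M (R1 r))); split.
  + rewrite /= -/c1 !size_cat /= -!catA addn1 addSnnS E1 -/c1.
    rewrite (step _ _ _ _ _ (Read r r)); first by rewrite addnS.
    rewrite catA nth_cat !size_cat ltnn.
    by rewrite (_ : _ - _ = 0) //; lia.
  + by rewrite /upd eqxx V1.
  + move=> i ir; rewrite /upd; case: eqP => [E|_]; first by rewrite E ltnn in ir.
    exact: F1.
Qed.

Lemma program_of_returns (V : finType) M a time (s t : V) :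
  size (program_of a) <= time ->
  returns (program_of a) M time s t (eval M (enum_rank s) (enum_rank t) a).
Proof.
rewrite size_rcons => h; rewrite /returns /program_of -cats1.
set R := nth _ _.
have [R' [E V' _]] := @exec_compile M a 2 [::] [:: Halt 2]
  (time - size (compile a 2)) R isT.
rewrite subnKC in E; last exact: ltnW.
rewrite /= in E; rewrite E add0n.
rewrite (_ : _ - _ = (time - (size (compile a 2)).+1).+1); last lia.
by rewrite /= nth_cat ltnn subnn /= V'.
Qed.

(** * Menger's theorem *)

(* Rado's argument: as long as some [N x] has two elements, submodularity of
   [#|_|] allows to delete one of them without violating Hall's condition. *)
Lemma hall (L R : finType) (N : L -> {set R}) :
  (forall W : {set L}, #|W| <= #|\bigcup_(x in W) N x|) ->
  exists2 f : L -> R, injective f & forall x, f x \in N x.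
Proof.
have [m] := ubnP (\sum_x #|N x|); elim: m => // m IHm in N * => ltm HN.
have [/forallP N1|] := boolP [forall x, #|N x| <= 1].
  have N1E x : exists y, N x == [set y].
    suff /cards1P[y ->] : #|N x| == 1 by exists y.
    by rewrite eqn_leq N1 /=; have := HN [set x]; rewrite cards1 big_set1.
  exists (fun x => xchoose (N1E x)) => [x1 x2 E|x]; last first.
    by rewrite {2}(eqP (xchooseP (N1E x))) set11.
  apply/eqP/negPn/negP => x12; have := HN [set x1; x2].
  rewrite cards2 x12 big_setU1 /= ?inE // big_set1.
  by rewrite (eqP (xchooseP (N1E x1))) (eqP (xchooseP (N1E x2))) E setUid cards1.
rewrite negb_forall => /existsP[x]; rewrite -ltnNge => /card_gt1P.
move=> [y1 [y2 [xy1 xy2 y12]]].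
pose cutN y z := if z == x then N x :\ y else N z.
have cutN_sub y z : cutN y z \subset N z.
  by rewrite /cutN; case: eqP => // ->; apply: subD1set.
have [/forallP H|] := boolP [forall y, (y \in N x) ==>
    [exists W : {set L}, #|\bigcup_(z in W) cutN y z| < #|W|]]; last first.
  rewrite negb_forall => /existsP[y]; rewrite negb_imply negb_exists.
  case/andP=> xy /forallP HW.
  have [||f f_inj fN] := IHm (cutN y).
  - rewrite -ltnS; apply: leq_trans ltm; rewrite ltnS.
    rewrite (bigD1 x) //= [X in _ < X](bigD1 x) //= -addSn.
    apply: leq_add; last by apply: leq_sum => z _; apply: subset_leq_card.
    by rewrite /cutN eqxx [X in _ < X](cardsD1 y) xy.
  - by move=> W; rewrite leqNgt.
  - by exists f => // z; apply: (subsetP (cutN_sub y z)).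
(* Here every deletion from [N x] violates Hall's condition. A violating set must contain [x];
   removing [x] from it gives [W]. *)
have tight y : y \in N x -> exists W : {set L}, x \notin W /\
    #|(N x :\ y) :|: \bigcup_(z in W) N z| <= #|W|.
  move=> xy; have /existsP[W ltW] := implyP (H y) xy.
  have xW : x \in W.
    apply: contraLR ltW => xW; rewrite -leqNgt (leq_trans (HN W)) //.
    apply: subset_leq_card; apply/bigcupsP => z zW.
    apply: subset_trans (bigcup_sup z zW).
    by rewrite /cutN; case: eqP => // E; rewrite -E zW in xW.
  exists (W :\ x); split; first by rewrite !inE eqxx.
  rewrite -ltnS; apply: leq_trans (_ : #|W| <= _); last first.
    by rewrite (cardsD1 x W) xW.
  apply: leq_ltn_trans ltW; apply: subset_leq_card; rewrite subUset; apply/andP; split.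
    by apply: subset_trans (bigcup_sup x xW); rewrite /cutN eqxx.
  apply/bigcupsP => z; rewrite !inE => /andP[zx zW].
  by apply: subset_trans (bigcup_sup z zW); rewrite /cutN (negbTE zx).
have [W1 [xW1 le1]] := tight _ xy1; have [W2 [xW2 le2]] := tight _ xy2.
set D1 := _ :|: _ in le1; set D2 := _ :|: _ in le2.
(* Since [y1 != y2], [D1 :|: D2] contains all of [N x], so Hall's condition gains one from [x].
   Together with [leI] this contradicts [cardsUI]. *)
have leU : #|W1 :|: W2|.+1 <= #|D1 :|: D2|.
  have -> : #|W1 :|: W2|.+1 = #|x |: (W1 :|: W2)|.
    by rewrite cardsU1 !inE negb_or xW1 xW2.
  apply: leq_trans (HN _) _; apply: subset_leq_card; apply/bigcupsP => z.
  rewrite !inE => /orP[/eqP-> |/orP[zW|zW]].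
  - apply/subsetP => y yN; rewrite !inE yN !andbT.
    by case: (y =P y1) => [->|]; rewrite ?y12 ?orbT.
  - by rewrite (subset_trans (bigcup_sup z zW)) // -setUA setUC -setUA subsetUl.
  - by rewrite (subset_trans (bigcup_sup z zW)) // /D2 setUA subsetUr.
have leI : #|W1 :&: W2| <= #|D1 :&: D2|.
  apply: leq_trans (HN _) _; apply: subset_leq_card; apply/bigcupsP => z.
  rewrite !inE => /andP[z1 z2]; rewrite subsetI.
  by rewrite !(subset_trans _ (subsetUr _ _)) //; apply: bigcup_sup.
have := cardsUI D1 D2; have := cardsUI W1 W2; lia.
Qed.

Section Menger.

Variables (V : finType) (e : rel V).
Implicit Types (s t : V) (A B : {set V}).

(** Ordered pairs: an edge between disjoint [A] and [B] counts once, oriented from [A] to [B]. *)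
Definition crossing A B : {set V * V} :=
  [set u | [&& u.1 \in A, u.2 \in B & e u.1 u.2]].

Definition cut_size A B := #|~: (A :|: B)| + #|crossing A B|.

(** Charge each path to the place where it first leaves [A]: to the edge it takes if that leads into
    [B], otherwise to the node it reaches. *)
Lemma kappa_le_cut_size s t A B :
  [disjoint A & B] -> s \in A -> t \in B -> kappa e s t <= cut_size A B.
Proof.
move=> dAB sA tB.
have tA : t \notin A by rewrite (disjointFl dAB).
apply/bigmax_leqP => P /andP[/forallP Ppath /forallP Pdisj].
pose g (p : {bseq #|V| of V}) : V + V * V :=
  let i := find (fun y => y \notin A) p in
  let y := nth t p i in
  if y \in B then inr (nth s (s :: p) i, y) else inl y.
pose K : {set V + V * V} := (inl @: ~: (A :|: B)) :|: (inr @: crossing A B).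
have leK : #|K| <= cut_size A B.
  by apply: leq_trans (leq_card_setU _ _) _; apply: leq_add; apply: leq_imset_card.
apply: leq_trans leK.
have Pst p : p \in P -> st_path e s t p by apply/implyP/Ppath.
have Pid p q : p \in P -> q \in P -> p != q -> internally_disjoint t p q.
  by move=> pP qP; move/(_ p)/implyP/(_ pP)/forallP/(_ q)/implyP/(_ qP)/implyP: Pdisj.
have exit (p : {bseq #|V| of V}) : p \in P -> let i := find (fun y => y \notin A) p in
    [/\ i < size p, nth t p i \notin A, nth s (s :: p) i \in A
      & e (nth s (s :: p) i) (nth t p i)].
  move=> /Pst/and3P[ep /eqP lp _] i.
  have hasp : has (fun y => y \notin A) p.
    apply/hasP; exists t => //; have := mem_last s p; rewrite lp inE.
    by case: eqP tA => [->|//]; rewrite sA.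
  have ltp : i < size p by rewrite -has_find.
  split=> //; first exact: (nth_find t hasp).
    case E: i => [|j] //=; apply/negPn; rewrite -[_ \notin A]/((fun y => y \notin A) _).
    by rewrite before_find // -/i E.
  by rewrite (set_nth_default s t ltp); move/pathP: ep => /(_ s i ltp).
have inn (p q : {bseq #|V| of V}) x : p \in P -> q \in P -> x != t ->
    x \in val p -> x \in val q -> p = q.
  move=> pP qP xt xp xq; apply/eqP/negPn/negP => /(Pid _ _ pP qP)/negP; apply.
  by apply/hasP; exists x; rewrite /= mem_filter xt.
(* Paths that both leave [A] by the edge [st] share no inner node there; but then both are the
   one-edge path, hence equal. *)
have single (p : {bseq #|V| of V}) : p \in P ->
    let i := find (fun y => y \notin A) p in
    nth s (s :: p) i = s -> nth t p i = t -> p = [:: t] :> seq V.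
  move=> pP i; have [ltp _ _ _] := exit p pP.
  have /and3P[_ lp up] := Pst p pP => xs.
  have -> : i = 0.
    apply/eqP; rewrite -(nth_uniq s _ _ up) /= ?xs //.
    by rewrite ltnS ltnW.
  case: (bseqval p) ltp lp up => [//|y q] _ /= lp up yt; rewrite yt in lp up *.
  case/lastP: q lp up => [//|q z]; rewrite last_rcons => /eqP->.
  by rewrite mem_rcons inE eqxx /= andbF.
rewrite -(@card_in_imset _ _ g P).
  apply: subset_leq_card; apply/subsetP => u /imsetP[p pP ->].
  have [ltp yA xA exy] := exit p pP; rewrite /g.
  rewrite inE; case: ifPn => yB; apply/orP; [right|left]; apply: imset_f.
    by rewrite inE /= xA yB.
  by rewrite !inE negb_or yA.
move=> p q pP qP.
have [ltp yA xA exy] := exit p pP; have [ltq yA' xA' exy'] := exit q qP.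
have sp := single p pP; have sq := single q qP.
rewrite /g; case: ifPn => yB; case: ifPn => yB' // [].
  move=> ex ey; have [yt|yt] := eqVneq (nth t p (find (fun y => y \notin A) p)) t.
    have [xs|xs] := eqVneq (nth s (s :: p) (find (fun y => y \notin A) p)) s.
      by apply: val_inj; rewrite /= sp // sq -?ex -?ey.
    apply: (inn _ _ (nth s (s :: p) (find (fun y => y \notin A) p)) pP qP).
    - by apply/eqP => E; move: xA tA; rewrite E => ->.
    - have := mem_nth s (leqW ltp : _ < size (s :: p)).
      by rewrite inE (negbTE xs).
    - have := mem_nth s (leqW ltq : _ < size (s :: q)).
      by rewrite inE -ex (negbTE xs).
  by apply: (inn _ _ _ pP qP yt); [|rewrite ey]; apply: mem_nth.
move=> ey; apply: (inn _ _ _ pP qP _ (mem_nth t ltp)).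
  by apply/eqP => E; rewrite E tB in yB.
by rewrite ey mem_nth.
Qed.

(** Distinctness is required separately because [[:: t]] is internally disjoint from itself. *)
Lemma kappa_ge_family s t (I : finType) (F : I -> seq V) :
  (forall i, st_path e s t (F i)) ->
  (forall i j, i != j -> F i != F j /\ internally_disjoint t (F i) (F j)) ->
  #|I| <= kappa e s t.
Proof.
move=> Fst Fdisj.
have Fsize i : size (F i) <= #|V|.
  have /and3P[_ _ /andP[_ uF]] := Fst i; rewrite -(card_uniqP uF); exact: max_card.
pose b i : {bseq #|V| of V} := Bseq (Fsize i).
have b_inj : injective b.
  move=> i j /(congr1 val) /= E; apply/eqP/negPn/negP => /Fdisj[].
  by rewrite E eqxx.
rewrite -cardsT -(card_imset _ b_inj); apply: leq_bigmax_cond.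
apply/andP; split.
  by apply/forallP => p; apply/implyP => /imsetP[i _ ->]; apply: Fst.
apply/forallP => p; apply/implyP => /imsetP[i _ ->].
apply/forallP => q; apply/implyP => /imsetP[j _ ->]; apply/implyP => ij.
have /Fdisj[] // : i != j by apply: contra ij => /eqP->.
Qed.

(* Matchings of the bipartite graph [hop] on two copies of ['I_p + V] encode
   [p] internally disjoint [st]-paths with an inner node: [inl i] is the [i]-th
   copy of [s] on the left, and the [i]-th copy of [t] on the right; a node of
   [V] is matched with its successor, or with itself if no path visits it. *)
Definition hop s t p (u : 'I_p + V) : {set 'I_p + V} :=
  [set v | match u, v with
           | inl _, inl _ => false
           | inl _, inr y => [&& e s y, y != s & y != t]
           | inr x, inl _ => [&& e x t, x != s & x != t]
           | inr x, inr y =>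
               (x == y) || [&& e x y, x != s, x != t, y != s & y != t]
           end].

(** Iterating [f] from the [i]-th copy of [s] traces a path until a copy of [t] is reached. The edge
    [st], if present, is one more path. *)
Lemma kappa_ge_matching s t p (f : 'I_p + V -> 'I_p + V) :
  s != t -> injective f -> (forall u, f u \in hop s t u) ->
  p + e s t <= kappa e s t.
Proof.
move=> st f_inj fN.
pose src i : 'I_p + V := inl i.
pose is_inl (u : 'I_p + V) := if u is inl _ then true else false.
(* An injective self-map of a finite type has only cycles, so the orbit of [src i] returns to some
   [inl]; [len i] counts the inner nodes before the first return. *)
have back i : exists m, is_inl (iter m.+1 f (src i)).
  by exists (order f (src i)).-1; rewrite prednK ?order_gt0 // iter_order.
pose len i := ex_minn (back i).
pose x i a := if iter a.+1 f (src i) is inr v then v else s.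
have xE i a : a < len i -> iter a.+1 f (src i) = inr (x i a).
  rewrite /len /x; case: ex_minnP => m _ minm am.
  by case E: (iter _ _ _) => [j|//]; have := minm a; rewrite E leqNgt am => /(_ isT).
have endE i : is_inl (iter (len i).+1 f (src i)).
  by rewrite /len; case: ex_minnP.
have len_gt0 i : 0 < len i.
  rewrite lt0n; apply/eqP => E; have := endE i; rewrite E /= => H.
  by have := fN (src i); rewrite inE /=; case: (f _) H.
(* Cancelling [f] makes [src i] an iterate of [src j] before the first return, hence the zeroth one.
   This shows at once that the paths are simple and disjoint. *)
have x_inj i j a b : a < len i -> b < len j -> x i a = x j b -> i = j /\ a = b.
  wlog ab : i j a b / a <= b => [W ai bj E|ai bj E].
    have [ab|/ltnW ba] := leqP a b; first exact: W.
    by have [] := W j i b a ba bj ai (esym E).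
  have : iter a.+1 f (src i) = iter a.+1 f (iter (b - a) f (src j)).
    by rewrite -iterD addSn subnKC // !xE // E.
  have iinj m : injective (iter m f) by elim: m => //= m IH u v /f_inj/IH.
  move/iinj; case E': (b - a) => [|c]; last by rewrite xE //; lia.
  by move=> ij; split; [case: ij | lia].
have x_st i a : a < len i -> x i a != s /\ x i a != t.
  elim: a => [|a IHa] ai.
    by have := fN (src i); rewrite -[f _]/(iter 1 f _) (xE _ _ ai) inE => /and3P[].
  have := fN (inr (x i a)); rewrite -(xE _ _ (ltnW ai)) -iterS (xE _ _ ai).
  rewrite (xE _ _ (ltnW ai)) inE; case/orP => [/eqP<-|/and5P[]//].
  exact: IHa (ltnW ai).
have x_fst i : e s (x i 0).
  have := fN (src i); rewrite -[f _]/(iter 1 f _) (xE _ _ (len_gt0 i)) inE.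
  by case/and3P.
have x_next i a : a.+1 < len i -> e (x i a) (x i a.+1).
  move=> ai; have := fN (inr (x i a)).
  rewrite -(xE _ _ (ltnW ai)) -iterS (xE _ _ ai) (xE _ _ (ltnW ai)) inE.
  case/orP => [/eqP/x_inj[]|/and5P[]] //; first exact: ltnW.
  by move=> _ /n_Sn.
have x_last i : e (x i (len i).-1) t.
  have li : (len i).-1 < len i by rewrite prednK.
  have := fN (inr (x i (len i).-1)).
  rewrite -{1}(xE _ _ li) -iterS prednK // inE.
  by have := endE i; case: (iter _ _ _) => // j _ /and3P[].
pose F i := rcons (mkseq (x i) (len i)) t.
have innF i : inner t (F i) = mkseq (x i) (len i).
  rewrite /inner /F filter_rcons eqxx /=; apply/all_filterP/allP => y.
  by case/mapP=> a; rewrite mem_iota /= => /x_st[_ yt] ->.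
have Fst i : st_path e s t (F i).
  apply/and3P; split; last 1 first.
  - rewrite cons_uniq mem_rcons inE negb_or st rcons_uniq.
    apply/and3P; split; last by apply/mkseq_uniqP => a b ai bi /x_inj[].
      by apply/mapP => -[a]; rewrite mem_iota => /x_st[/eqP/nesym].
    by apply/mapP => -[a]; rewrite mem_iota => /x_st[_ /eqP/nesym].
  - rewrite /F rcons_path; apply/andP; split.
      apply/(pathP s) => a; rewrite size_mkseq => ai.
      rewrite nth_mkseq //; case: a ai => [|a] ai /=; first exact: x_fst.
      by rewrite nth_mkseq ?x_next // ltnW.
    have := x_last i; case: (len i) (len_gt0 i) => // m _.
    by rewrite (last_nth s) size_mkseq -[nth _ _ m.+1]/(nth s _ m) nth_mkseq.
  - by rewrite last_rcons.
have Fdisj i j : i != j -> internally_disjoint t (F i) (F j).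
  move=> ij; apply/hasPn => y; rewrite !innF /= => /mapP[b]; rewrite mem_iota => bj ->.
  apply/mapP => -[a]; rewrite mem_iota => ai /x_inj[] // E; by rewrite E eqxx in ij.
have Fneq i j : i != j -> F i != F j.
  move=> ij; apply/eqP => /(congr1 (inner t)); rewrite !innF => E.
  have := congr1 (head s) E; rewrite -!nth0 !nth_mkseq //.
  by case/x_inj => // E'; rewrite E' eqxx in ij.
have [est|_] := boolP (e s t); last first.
  by rewrite addn0 -[p]card_ord; apply: kappa_ge_family Fst _ => i j ij; split; auto.
rewrite addn1 -[p.+1]/(p.+1) -{1}[p]card_ord -card_option.
apply: (@kappa_ge_family _ _ _ (fun o => if o is Some i then F i else [:: t])).
  by case=> [i|] //; rewrite /st_path /= est eqxx inE st.
have inn0 : inner t [:: t] = [::] by rewrite /inner /= eqxx.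
have Fnil i : F i != [:: t].
  apply/eqP => /(congr1 (inner t)); rewrite inn0 innF => /(congr1 size).
  by rewrite size_mkseq; have := len_gt0 i; case: (len i).
case=> [i|] [j|] ij.
- have ij' : i != j by apply: contra ij => /eqP->.
  by split; auto.
- by split=> //; rewrite /internally_disjoint inn0.
- by rewrite eq_sym; split=> //; rewrite /internally_disjoint inn0; apply/hasPn.
- by rewrite eqxx in ij.
Qed.

(** A matching [f] of all left nodes along [hop] would give more than [kappa e s t] paths, so Hall's
    condition fails, and a deficient set [W] yields the cut. *)
Lemma menger s t : s != t -> exists A B,
  [/\ [disjoint A & B], s \in A, t \in B, #|crossing A B| <= 1
    & cut_size A B <= kappa e s t].
Proof.
move=> st; pose p := (kappa e s t).+1 - e s t.
have [/forallP HW|] := boolP [forall W : {set 'I_p + V},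
    #|W| <= #|\bigcup_(u in W) @hop s t p u|].
  have [f f_inj fN] := hall HW.
  have := kappa_ge_matching st f_inj fN; rewrite /p.
  by case: (e s t); lia.
rewrite negb_forall => /existsP[W]; rewrite -ltnNge; set N := \bigcup_(u in W) _.
move=> ltW.
have inN u v : u \in W -> v \in hop s t u -> v \in N by move=> uW uv; apply/bigcupP; exists u.
(* These are the nodes of [W] and of its neighbourhood. A node may be matched with itself, so [Y]
   lies in [Z]; the fewer than [p] nodes of [Z :\: Y] will form the node part of the cut. *)
pose Y := [set x | inr x \in W]; pose Z := [set x | inr x \in N].
have YZ : Y \subset Z.
  by apply/subsetP => x; rewrite !inE => /inN; apply; rewrite inE eqxx.
have cardE : p + #|Y| = #|[set inl i | i in 'I_p] : {set 'I_p + V}|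
                        + #|[set inr x | x in Y] : {set 'I_p + V}|.
  by rewrite !card_imset ?card_ord //; [apply: inr_inj | apply: inl_inj].
have cardW : #|W| <= p + #|Y|.
  rewrite cardE.
  apply: leq_trans (leq_card_setU _ _); apply: subset_leq_card.
  apply/subsetP => -[i|x] uW; rewrite inE; first by rewrite imset_f.
  by rewrite [X in _ || X]imset_f ?orbT // inE.
have cardZ : #|Z| <= #|N|.
  rewrite -(card_imset Z (@inr_inj 'I_p V)); apply: subset_leq_card.
  by apply/subsetP => u /imsetP[x]; rewrite inE => xN ->.
have [i0 iW] : exists i, inl i \in W.
  apply/existsP; apply: contraLR ltW; rewrite negb_exists => /forallP noW.
  rewrite -leqNgt; apply: leq_trans cardZ; apply: leq_trans (subset_leq_card YZ).
  rewrite -(card_imset Y (@inr_inj 'I_p V)); apply: subset_leq_card.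
  apply/subsetP => -[i|x] uW; first by have := noW i; rewrite uW.
  by rewrite imset_f // inE.
(* Such an edge would put all [p] copies of [t] into [N], whence [#|W| <= p + #|Y| <= #|N|]. *)
have noT x : x \in Y -> x != s -> x != t -> ~~ e x t.
  rewrite inE => xW xs xt; apply: contraL ltW => ext; rewrite -leqNgt.
  apply: leq_trans cardW _.
  rewrite cardE.
  rewrite -cardsUI [X in _ + X](_ : _ = 0) ?addn0; last first.
    apply: eq_card0 => u; rewrite inE; apply/negP => /andP[/imsetP[i _ ->]].
    by case/imsetP.
  apply: subset_leq_card; apply/subsetP => u; rewrite inE => /orP[] /imsetP[].
    by move=> i _ ->; apply: (inN _ _ xW); rewrite inE ext xs.
  by move=> y yY ->; have := subsetP YZ y yY; rewrite inE.
pose U := Z :\: Y; pose A := s |: (Y :\ t).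
have fixst y : y \in Z -> (y == s) || (y == t) -> y \in Y.
  rewrite !inE => /bigcupP[[i|x] uW]; rewrite inE.
    by case/and3P=> _ /negbTE-> /negbTE->.
  by case/orP=> [/eqP<-//|/and5P[_ _ _ /negbTE-> /negbTE->]].
have tA : t \notin A by rewrite !inE eqxx orbF eq_sym.
have tU : t \notin U.
  apply/negP; rewrite inE => /andP[tY /fixst].
  by rewrite eqxx orbT (negbTE tY) => /(_ isT).
exists A, (~: (A :|: U)).
(* Apart from [st], an edge leaving [A] either ends in [t], which [noT] excludes, or ends in [Z],
   hence in [U]. *)
have leX : #|crossing A (~: (A :|: U))| <= e s t.
  have sub : crossing A (~: (A :|: U)) \subset [set u | (u == (s, t)) && e s t].
    apply/subsetP => -[x y]; rewrite inE /= => /and3P[xA]; rewrite !inE.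
    rewrite !negb_or => /andP[/andP[ys yY]] yU exy.
    rewrite xpair_eqE; move: xA; rewrite !inE => xA.
    have [yt|yt] := eqVneq y t.
      have [xs|xs] := eqVneq x s; first by rewrite -xs -yt exy.
      move: xA; rewrite (negbTE xs) => /andP[xt xW].
      by have := noT x; rewrite inE -yt exy => /(_ xW xs); rewrite yt => /(_ xt).
    have yN : inr y \notin N.
      by move: yU yY; rewrite yt => /nandP[/negPn->|].
    case/negP: yN; have [xs|xs] := eqVneq x s.
      by apply: (inN _ _ iW); rewrite inE -xs exy xs ys yt.
    move: xA; rewrite (negbTE xs) => /andP[xt xW].
    by apply: (inN _ _ xW); rewrite inE exy xs xt ys yt orbT.
  apply: leq_trans (subset_leq_card sub) _; case: (e s t).
    rewrite [nat_of_bool _]/= -(cards1 (s, t)); apply: subset_leq_card.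
    by apply/subsetP => u; rewrite !inE andbT.
  by rewrite leqn0 cards_eq0; apply/eqP/setP => u; rewrite !inE andbF.
split.
- rewrite -setI_eq0; apply/eqP/setP => x; rewrite !inE.
  by case: (x == s); case: (x == t); case: (inr x \in W).
- by rewrite !inE eqxx.
- by rewrite in_setC in_setU negb_or tA tU.
- by apply: leq_trans leX _; case: (e s t).
have leU : #|~: (A :|: ~: (A :|: U))| <= #|U|.
  apply: subset_leq_card; apply/subsetP => x.
  rewrite in_setC in_setU in_setC in_setU negb_or negbK.
  by case/andP=> /negbTE->.
have cU : #|U| + #|Y| = #|Z|.
  by rewrite -(cardsID Y Z) (setIidPr YZ) addnC.
rewrite /cut_size; have : #|U| < p by lia.
by move: leX; rewrite /p; case: (e s t) => /=; lia.
Qed.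

End Menger.

(** * Uncrossing *)

Section Uncrossing.

Variables (V : finType) (e : rel V) (k : nat).
Hypothesis e_sym : symmetric e.
Hypothesis e_conn : k_connected e k.
Implicit Types (s t : V) (A B : {set V}) (c d : {set V} * {set V}).

Local Notation cut_size := (cut_size e).

Lemma cut_sizeC A B : cut_size A B = cut_size B A.
Proof.
rewrite /cut_size setUC; congr (_ + _).
have swap_inj : injective (fun u : V * V => (u.2, u.1)).
  by move=> [x y] [x' y'] [-> ->].
rewrite -(card_imset _ swap_inj); apply: eq_card => -[y x].
apply/imsetP/idP => [[[x' y']]|]; rewrite inE /= => /and3P[xA yB exy].
  by case=> -> ->; rewrite inE /= yB xA e_sym.
by exists (x, y); rewrite // inE /= yB xA e_sym.
Qed.

(** Both sides are sums over nodes and over ordered pairs, and the inequality holds summand by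
    summand. *)
Lemma cut_size_uncross A B A' B' :
  cut_size (A :&: A') (B :|: B') + cut_size (A :|: A') (B :&: B')
    <= cut_size A B + cut_size A' B'.
Proof.
have cE X Y : cut_size X Y = \sum_v ((v \notin X) && (v \notin Y) : nat)
    + \sum_u ([&& u.1 \in X, u.2 \in Y & e u.1 u.2] : nat).
  rewrite /cut_size -!sum1_card; congr (_ + _);
    by rewrite big_mkcond; apply: eq_bigr => u _; rewrite !inE ?negb_or; case: ifP.
have swap (m n p q : nat) : m + n + (p + q) = m + p + (n + q) by lia.
rewrite !cE swap [X in _ <= X]swap -!big_split /=; apply: leq_add; apply: leq_sum => u _;
  rewrite !inE.
  by case: (u \in A); case: (u \in A'); case: (u \in B); case: (u \in B').
by case: (u.1 \in A); case: (u.1 \in A'); case: (u.2 \in B); case: (u.2 \in B');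
  case: (e _ _).
Qed.

Lemma cut_size_ge s t A B :
  [disjoint A & B] -> s \in A -> t \in B -> k <= cut_size A B.
Proof.
move=> dAB sA tB; apply: leq_trans (kappa_le_cut_size e dAB sA tB).
by apply: e_conn; apply/eqP => E; have := disjointFr dAB sA; rewrite E tB.
Qed.

(** The bound on [#|c.1|] holds for the smaller side of every cut of size at least [k] with at most
    one crossing edge, since at least [k - 1] nodes then lie outside of both sides. *)
Definition small_cut s c :=
  [&& [disjoint c.1 & c.2], s \in c.1, c.2 != set0, cut_size c.1 c.2 <= k
    & 2 * #|c.1| + k <= #|V|.+1].

(* The bound on [#|A|] in [small_cut] leaves [k] nodes outside of [A :|: A'], which
   bounds the size of the second cut even when [B :&: B'] is empty. *)
Lemma small_cut_meet s c d :
  small_cut s c -> small_cut s d -> small_cut s (c.1 :&: d.1, c.2 :|: d.2).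
Proof.
case: c d => [A B] [A' B'] /and5P[/= dAB sA nB cAB szA].
case/and5P=> /= dAB' sA' nB' cAB' szA'; have cU := cardsUI A A'.
have IA : 0 < #|A :&: A'| by apply/card_gt0P; exists s; rewrite inE sA sA'.
apply/and5P; split=> /=.
- rewrite -setI_eq0 setIUr setU_eq0 !setI_eq0.
  by rewrite (disjointWl (subsetIl _ _) dAB) (disjointWl (subsetIr _ _) dAB').
- by rewrite inE sA sA'.
- by rewrite setU_eq0 negb_and nB.
- have := cut_size_uncross A B A' B'.
  suff : k <= cut_size (A :|: A') (B :&: B') by lia.
  have [E|/set0Pn[t tB]] := eqVneq (B :&: B') set0.
    rewrite E /cut_size setU0; have cC : #|A :|: A'| + #|~: (A :|: A')| = #|V| := cardsC _.
    apply: leq_trans (leq_addr _ _); move: cC cU IA szA szA'.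
    move: #|A| #|A'| #|A :|: A'| #|~: (A :|: A')| #|A :&: A'| #|V|; lia.
  apply: (@cut_size_ge s t) => //; last by rewrite inE sA.
  rewrite -setI_eq0 setIUl setU_eq0 !setI_eq0.
  by rewrite (disjointWr (subsetIl _ _) dAB) (disjointWr (subsetIr _ _) dAB').
- have := subset_leq_card (subsetIl A A'); lia.
Qed.

(** Minimise [#|c.1| + #|~: c.2|]. Meeting with another small cut increases neither term, so by
    minimality it changes neither set. *)
Lemma small_cut_least s c0 : small_cut s c0 ->
  exists2 c, small_cut s c & forall d, small_cut s d -> c.1 \subset d.1 /\ d.2 \subset c.2.
Proof.
move=> g0; case: (arg_minnP (fun c => #|c.1| + #|~: c.2|) g0) => c gc minc.
exists c => // d gd; have /minc /= := small_cut_meet gc gd.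
have := subset_leq_card (subsetIl c.1 d.1).
have sC : ~: (c.2 :|: d.2) \subset ~: c.2 by rewrite setCS subsetUl.
have := subset_leq_card sC => le2 le1 le3.
have /eqP/setIidPl-> : c.1 :&: d.1 == c.1.
  rewrite eqEcard subsetIl -(leq_add2r #|~: c.2|) (leq_trans le3) //.
  by rewrite leq_add2l.
have : ~: (c.2 :|: d.2) == ~: c.2.
  rewrite eqEcard sC -(leq_add2l #|c.1|) (leq_trans le3) //.
  by rewrite leq_add2r.
by move/eqP/setC_inj/setUidPl.
Qed.

(* [A s] is the whole set of nodes when no cut of size [k] has [s] on its
   smaller side. *)
Lemma least_cuts : exists A B : V -> {set V},
  [/\ forall s, s \in A s /\ [disjoint A s & B s],
      forall s, cut_size (A s) (B s) <= k,
      forall s t, s != t ->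
        (kappa e s t <= k) = (t \in B s) || (s \in B t)
    & forall s t, s \notin ~: (A t :|: B t) -> t \notin ~: (A s :|: B s) ->
        [\/ A s \subset A t, A t \subset A s | [disjoint A s & A t]]].
Proof.
have /fin_all_exists[c cP] s : exists c,
    [/\ s \in c.1, [disjoint c.1 & c.2], c.2 != set0 -> small_cut s c,
        c.2 = set0 -> c.1 = setT
      & forall d, small_cut s d -> c.1 \subset d.1 /\ d.2 \subset c.2].
  have [/existsP[c0 /small_cut_least[c gc minc]]|] := boolP [exists c, small_cut s c].
    exists c; have /and5P[dc sc nc _ _] := gc; split=> // E.
    by rewrite E eqxx in nc.
  rewrite negb_exists => /forallP ng; exists (setT, set0); split=> //=.
  - by rewrite disjoints_subset setC0 subxx.
  - by rewrite eqxx.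
  - by move=> d gd; have := ng d; rewrite gd.
exists (fun s => (c s).1), (fun s => (c s).2); split.
- by move=> s; have [] := cP s.
- move=> s; have [_ _ g sT _] := cP s; have [E|/g/and5P[]//] := eqVneq (c s).2 set0.
  rewrite /cut_size (sT E) E setU0 setCT cards0 (_ : crossing _ _ _ = set0) ?cards0 //.
  by apply/setP => u; rewrite !inE andbF.
- have sep s t : t \in (c s).2 -> kappa e s t <= k.
    move=> tB; have [sA dAB g _ _] := cP s.
    have /and5P[_ _ _ le _] : small_cut s (c s) by apply: g; apply/set0Pn; exists t.
    exact: leq_trans (kappa_le_cut_size e dAB sA tB) le.
  (* The cut from Menger's theorem has at most one crossing edge, so its smaller side is a small cut
     of [s] or of [t], and the least cut has an even larger second set. *)
  have kappaC s t : s != t -> kappa e s t <= k -> t \in (c s).2 \/ s \in (c t).2.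
    move=> st lek; have [A [B [dAB sA tB le1 le]]] := menger e st.
    have ge := cut_size_ge dAB sA tB.
    have cAB : #|A| + #|B| + #|~: (A :|: B)| = #|V|.
      by rewrite -(cardsC (A :|: B)) cardsU disjoint_setI0 // cards0 subn0.
    have small : #|A| + #|B| + k <= #|V|.+1.
      move: ge cAB le1; rewrite /cut_size.
      by move: #|A| #|B| #|~: (A :|: B)| #|crossing e A B| #|V|; lia.
    have [leA|/ltnW leA] := leqP #|A| #|B|; [left|right].
      have [_ _ _ _ /(_ (A, B))[|_ sub]] := cP s; last exact: subsetP sub t tB.
      apply/and5P; split=> //=; first by apply/set0Pn; exists t.
        exact: leq_trans le lek.
      by move: small leA; move: #|A| #|B| #|V|; lia.
    have [_ _ _ _ /(_ (B, A))[|_ sub]] := cP t; last exact: subsetP sub s sA.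
    apply/and5P; split=> //=; first by rewrite disjoint_sym.
    - by apply/set0Pn; exists s.
    - by rewrite cut_sizeC (leq_trans le).
    - by move: small leA; move: #|A| #|B| #|V|; lia.
  move=> s t st; apply/idP/orP; first exact: kappaC.
  case=> [/sep //|sB]; have [tA dAB g _ _] := cP t.
  have /and5P[_ _ _ le _] : small_cut t (c t) by apply: g; apply/set0Pn; exists s.
  rewrite disjoint_sym in dAB; apply: leq_trans (kappa_le_cut_size e dAB sB tA) _.
  by rewrite cut_sizeC.
- move=> s t; rewrite !inE !negb_or !negb_and !negbK => sU tU.
  have [sA dAB gs sT mins] := cP s; have [tA dAB' gt tT mint] := cP t.
  have [E|nB] := eqVneq (c s).2 set0.
    by constructor 2; rewrite (sT E) subsetT.
  have [E|nB'] := eqVneq (c t).2 set0.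
    by constructor 1; rewrite (tT E) subsetT.
  have {gs}gs := gs nB; have {gt}gt := gt nB'.
  (* A small cut of [x] is also one of each node [y] on its first side; so if [s] is in [(c t).1],
     leastness gives [(c s).1 \subset (c t).1]. *)
  have mono x y d : small_cut x d -> y \in d.1 -> small_cut y d by case/and5P=> *; apply/and5P.
  have [sAt|sAt] := boolP (s \in (c t).1).
    by constructor 1; have [] := mins _ (mono _ s _ gt sAt).
  have [tAs|tAs] := boolP (t \in (c s).1).
    by constructor 2; have [] := mint _ (mono _ t _ gs tAs).
  have sB : s \in (c t).2 by rewrite (negbTE sAt) in sU.
  have tB : t \in (c s).2 by rewrite (negbTE tAs) in tU.
  (* Now each of [s], [t] is on the second side of the other's cut. Uncross [c s] with the reversed
     [c t]: one resulting pair still separates [s] from [t], so the other is a small cut of [s], and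
     leastness puts [(c s).1] inside [(c t).2]. *)
  have dU : [disjoint (c s).1 :|: (c t).2 & (c s).2 :&: (c t).1].
    rewrite -setI_eq0 setIUl setU_eq0 !setI_eq0 (disjointWr (subsetIl _ _) dAB).
    by rewrite disjoint_sym (disjointWl (subsetIr _ _) dAB').
  constructor 3; have [|sub _] := mins ((c s).1 :&: (c t).2, (c s).2 :|: (c t).1).
    have /and5P[_ _ _ le sz] := gs; have /and5P[_ _ _ le' _] := gt.
    apply/and5P; split=> /=.
    - rewrite -setI_eq0 setIUr setU_eq0 !setI_eq0 (disjointWl (subsetIl _ _) dAB).
      by rewrite disjoint_sym (disjointWr (subsetIr _ _) dAB').
    - by rewrite inE sA.
    - by rewrite setU_eq0 negb_and nB.
    - have := cut_size_uncross (c s).1 (c s).2 (c t).2 (c t).1.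
      rewrite (cut_sizeC (c t).2).
      have := @cut_size_ge s t _ _ dU; rewrite !inE sA tB tA => /(_ isT isT); lia.
    - by apply: leq_trans sz; rewrite leq_add2r leq_mul2l subset_leq_card ?subsetIl.
  rewrite disjoint_sym; apply: (disjointWr (subset_trans sub (subsetIr _ _))) => //.
Qed.

End Uncrossing.

(** * Colouring, linear orders and sparse tables *)

(** Pigeonhole, used for both the greedy colouring and first fit. *)
Lemma avoid_small_set (I : finType) (F : {set I}) m (g : I -> nat) :
  #|F| <= m -> exists2 v, v <= m & {in F, forall i, g i != v}.
Proof.
move=> leF; pose G : {set 'I_m.+1} := [set v : 'I_m.+1 | [exists i in F, g i == v]].
have leG : #|G| <= #|F|.
  apply: leq_trans (leq_imset_card (fun i => inord (g i) : 'I_m.+1) F).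
  apply: subset_leq_card; apply/subsetP => v; rewrite inE => /existsP[i /andP[iF /eqP gv]].
  by apply/imsetP; exists i => //; apply: val_inj; rewrite /= gv inordK.
have /existsP[v vG] : [exists v, v \notin G].
  rewrite -negb_forall; apply/forallP => allG; have : #|G| = m.+1.
    by rewrite -[RHS]card_ord; apply: eq_card => v; rewrite allG.
  lia.
exists v; first by rewrite -ltnS.
by move=> i iF; apply: contra vG => gv; rewrite inE; apply/existsP; exists i; rewrite iF.
Qed.

(* The conflict graph has at most [k #|S|] edges inside every set [S] of nodes,
   so that it is [2k]-degenerate. *)
Lemma conflict_colouring (V : finType) (U : V -> {set V}) k :
  (forall s, #|U s| <= k) ->
  exists2 c : V -> nat, forall s, c s <= 2 * k
    & forall s t, s != t -> c s = c t -> s \notin U t.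
Proof.
move=> leU.
suff H m (S : {set V}) : #|S| = m -> exists2 c : V -> nat, forall s, c s <= 2 * k
    & {in S &, forall s t, s != t -> c s = c t -> s \notin U t}.
  by have [c c1 c2] := H _ setT erefl; exists c => // s t; apply: c2.
elim: m S => [|m IHm] S cS.
  by exists (fun=> 0) => // s t; rewrite (card0_eq cS).
(* By averaging: each [t] causes at most [k] conflicts through [U t], so the degrees inside [S] sum
   to at most [2 * k * #|S|]. *)
have [s0 s0S deg] : exists2 s, s \in S
    & #|[set t in S | (t \in U s) || (s \in U t)]| <= 2 * k.
  apply/exists_inP; case: (boolP [exists _ in _, _]) => // /exists_inPn noS.
  have outdeg : \sum_(s in S) #|[set t in S | s \in U t]| <= k * #|S|.
    have cE (P : pred V) : #|[set t in S | P t]| = \sum_(t in S) P t.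
      by rewrite -sum1dep_card big_mkcondr; apply: eq_bigr => t _; case: (P t).
    rewrite (eq_bigr _ (fun s _ => cE _)) exchange_big /= mulnC -sum_nat_const.
    apply: leq_sum => t _; rewrite -cE (leq_trans _ (leU t)) // subset_leq_card //.
    by apply/subsetP => s; rewrite inE => /andP[].
  have : \sum_(s in S) (2 * k).+1 <= \sum_(s in S) (k + #|[set t in S | s \in U t]|).
    apply: leq_sum => s sS; have := noS s sS; rewrite -ltnNge => /leq_trans; apply.
    apply: leq_trans (_ : #|U s :|: [set t in S | s \in U t]| <= _).
      apply: subset_leq_card; apply/subsetP => t; rewrite !inE.
      by case/andP=> -> /orP[]->; rewrite ?orbT.
    by apply: leq_trans (leq_card_setU _ _) _; rewrite leq_add2r.
  rewrite big_split /= !sum_nat_const; nia.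
have [c c1 c2] : exists2 c : V -> nat, forall s, c s <= 2 * k
    & {in S :\ s0 &, forall s t, s != t -> c s = c t -> s \notin U t}.
  by apply: IHm; move: cS; rewrite (cardsD1 s0) s0S => -[].
have [v vk vF] := avoid_small_set c deg.
exists (fun s => if s == s0 then v else c s) => [s|s t sS tS st]; first by case: ifP.
have [ss0|ss0] := eqVneq s s0; have [tt0|tt0] := eqVneq t s0.
- by rewrite ss0 tt0 eqxx in st.
- move=> E; apply/negP => sU; have := vF t; rewrite -E eqxx => /(_ _)/negP H.
  by apply: H; rewrite // inE tS -ss0 sU orbT.
- move=> E; apply/negP => sU; have := vF s; rewrite E eqxx => /(_ _)/negP H.
  by apply: H; rewrite // inE sS -tt0 sU.
- by apply: c2; rewrite // !inE ?ss0 ?tt0.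
Qed.

(* Compare the vectors of memberships lexicographically, larger sets first. *)
Lemma laminar_convex (V : finType) (Xs : seq {set V}) :
  {in Xs &, forall A B : {set V}, [\/ A \subset B, B \subset A | [disjoint A & B]]} ->
  exists pos : V -> nat, {in Xs, forall (A : {set V}) u v w,
    u \in A -> w \in A -> pos u <= pos v -> pos v <= pos w -> v \in A}.
Proof.
pose le (A B : {set V}) := #|A| <= #|B|.
(* The induction also needs that nodes lying in the same sets get equal positions. *)
move=> lam; suff [pos _ posP] : exists2 pos : V -> nat,
    forall v w, {in Xs, forall A : {set V}, (v \in A) = (w \in A)} -> pos v = pos w
  & {in Xs, forall (A : {set V}) u v w,
      u \in A -> w \in A -> pos u <= pos v -> pos v <= pos w -> v \in A}.
  by exists pos.
have tot : total le by move=> A B; apply: leq_total.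
have tr : transitive le by move=> A B C; apply: leq_trans.
have lam' : {in sort le Xs &, forall A B : {set V},
    [\/ A \subset B, B \subset A | [disjoint A & B]]}.
  by move=> A B; rewrite !mem_sort; apply: lam.
suff [pos p1 p2] : exists2 pos : V -> nat,
    forall v w, {in sort le Xs, forall A : {set V}, (v \in A) = (w \in A)} -> pos v = pos w
  & {in sort le Xs, forall (A : {set V}) u v w,
      u \in A -> w \in A -> pos u <= pos v -> pos v <= pos w -> v \in A}.
  exists pos; first by move=> v w H; apply: p1 => A; rewrite mem_sort; apply: H.
  by move=> A AX; apply: p2; rewrite mem_sort.
have := sort_sorted tot Xs; move: (sort le Xs) lam' => {Xs lam}.
elim=> [|X Xs IH] lam; first by exists (fun=> 0).
rewrite /= (path_sortedE tr) => /andP[/allP minX /IH[|pos p1 p2]].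
  by move=> A B AX BX; apply: lam; rewrite inE ?AX ?BX orbT.
(* [X] is a smallest set, so every other one contains it or is disjoint from it, and the order built
   so far does not distinguish its nodes. *)
have posX u w : u \in X -> w \in X -> pos u = pos w.
  move=> uX wX; apply: p1 => A AX.
  have [||XA|AX'|d] := lam X A; rewrite ?inE ?eqxx ?AX ?orbT //.
  - by rewrite !(subsetP XA).
  - have /eqP-> : A == X by rewrite eqEcard AX'; apply: minX.
    by rewrite uX wX.
  - by rewrite !(disjointFr d).
(* Doubling leaves room to break ties by membership in [X]. *)
exists (fun v => 2 * pos v + (v \in X)) => [v w vw|A].
  rewrite (vw X) ?inE ?eqxx // (p1 v w) // => A AX.
  by apply: vw; rewrite inE AX orbT.
rewrite inE => /orP[/eqP->|AX] u v w uA wA uv vw.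
  have := posX _ _ uA wA; move: uv vw; rewrite uA wA; case: (v \in X) => //=; lia.
by apply: (p2 A AX u v w) => //; move: uv vw;
  case: (u \in X); case: (v \in X); case: (w \in X) => /=; lia.
Qed.

(** Ranks preserve the order, ties included, and are below [#|V|]; a convex set consists of the
    nodes between its least and its greatest rank. *)
Lemma laminar_intervals (V : finType) (Xs : seq {set V}) :
  {in Xs &, forall A B : {set V}, [\/ A \subset B, B \subset A | [disjoint A & B]]} ->
  exists2 pos : V -> nat, forall v, pos v < #|V|
    & {in Xs, forall A : {set V}, exists lo hi,
         [/\ lo <= #|V|, hi <= #|V| & forall v, (v \in A) = (lo <= pos v < hi)]}.
Proof.
move=> /laminar_convex[pos posP].
pose rk v := #|[set w | pos w < pos v]|.
have rk_lt v : rk v < #|V|.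
  rewrite -cardsT; apply: proper_card; rewrite properT.
  by apply/eqP => /setP/(_ v); rewrite !inE ltnn.
have rk_mono u v : rk u <= rk v -> pos u <= pos v.
  apply: contraLR; rewrite -!ltnNge => vu; apply: proper_card.
  apply/properP; split; first by apply/subsetP => w; rewrite !inE => /ltn_trans; apply.
  by exists v; rewrite !inE // ltnn.
exists rk => // A AX; have [->|[x xA]] := set_0Vmem A.
  by exists 0, 0; split=> // v; rewrite inE ltn0 andbF.
case: (arg_minnP rk xA) => u uA minu; case: (arg_maxnP rk xA) => w wA maxw.
exists (rk u), (rk w).+1; split=> // [|v]; first exact: ltnW.
apply/idP/andP => [vA|[uv vw]].
  by split; [apply: minu | rewrite ltnS; apply: maxw].
by apply: (posP A AX u v w) => //; apply: rk_mono.
Qed.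

(** Nodes of one colour do not conflict, so their sets are laminar and share the order [pos j]; only
    [2 * k + 1] orders are needed. *)
Lemma region_intervals (V : finType) (A U : V -> {set V}) k :
  (forall s, #|U s| <= k) ->
  (forall s t, s \notin U t -> t \notin U s ->
     [\/ A s \subset A t, A t \subset A s | [disjoint A s & A t]]) ->
  exists (c : V -> nat) (pos : nat -> V -> nat) (lo hi : V -> nat),
    [/\ forall s, c s <= 2 * k, forall j v, pos j v <= #|V|,
        forall s, lo s <= #|V|, forall s, hi s <= #|V|
      & forall s t, (t \in A s) = (lo s <= pos (c s) t < hi s)].
Proof.
move=> leU lam; have [c c1 c2] := conflict_colouring leU.
pose Xs j := [seq A s | s <- enum V & c s == j].
have /fin_all_exists2[pos p1 p2] (j : 'I_(2 * k).+1) :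
    exists2 pos : V -> nat, forall v, pos v < #|V|
    & {in Xs j, forall A : {set V}, exists lo hi,
         [/\ lo <= #|V|, hi <= #|V| & forall v, (v \in A) = (lo <= pos v < hi)]}.
  apply: laminar_intervals => _ _ /mapP[s + ->] /mapP[t + ->].
  rewrite !mem_filter => /andP[/eqP cs _] /andP[/eqP ct _].
  have [->|st] := eqVneq s t; first by constructor 1.
  by apply: lam; apply: c2; rewrite ?cs ?ct // eq_sym.
pose col s := Ordinal (c1 s : c s < (2 * k).+1).
have /fin_all_exists[b bP] s : exists b : nat * nat, [/\ b.1 <= #|V|, b.2 <= #|V|
    & forall v, (v \in A s) = (b.1 <= pos (col s) v < b.2)].
  have [|lo [hi bP]] := p2 (col s) (A s); last by exists (lo, hi).
  by apply: map_f; rewrite mem_filter eqxx mem_enum.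
exists c, (fun j => if insub j is Some j' then pos j' else fun=> 0),
  (fun s => (b s).1), (fun s => (b s).2); split=> //.
- by move=> j v; case: insub => // j'; apply: ltnW.
- by move=> s; have [] := bP s.
- by move=> s; have [] := bP s.
- by move=> s t; have [_ _ ->] := bP s; rewrite (valK (col s)).
Qed.

(* Greedy choice of the values of [h], each of them in a bucket with at most
   the average number of collisions. *)
Lemma balanced_buckets (I V : finType) (U : I -> {set V}) k :
  0 < k -> (forall i, #|U i| <= k) ->
  exists h : V -> 'I_k,
    \sum_i \sum_b #|[set x in U i | h x == b]| ^ 2 <= 2 * (k * #|I|).
Proof.
case: k => // k _ leU; set k1 := k.+1.
pose Q (S : {set V}) (h : V -> 'I_k1) :=
  \sum_i \sum_b #|[set x in U i :&: S | h x == b]| ^ 2.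
(* The right-hand side bounds [k1] times the expectation of [Q S h] for a random [h]. *)
suff H m (S : {set V}) : #|S| = m -> exists h : V -> 'I_k1,
    k1 * Q S h <= \sum_i (#|U i :&: S| ^ 2 + k1 * #|U i :&: S|).
  have [h hP] := H _ setT erefl; exists h.
  rewrite -(leq_pmul2l (ltn0Sn k)) -/k1; apply: leq_trans (_ : k1 * Q setT h <= _).
    rewrite leq_mul2l; apply/orP; right; apply: eq_leq.
    by apply: eq_bigr => i _; apply: eq_bigr => b _; rewrite setIT.
  apply: leq_trans hP _.
  apply: leq_trans (_ : \sum_(i : I) 2 * (k1 * k1) <= _); last first.
    by rewrite sum_nat_const (_ : #|_| = #|I|) //; nia.
  apply: leq_sum => i _; rewrite setIT; have := leU i; rewrite -/k1; nia.
elim: m S => [|m IHm] S cS.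
  exists (fun=> ord0); rewrite /Q (cards0_eq cS).
  rewrite big1 ?muln0 // => i _; rewrite big1 // => b _.
  by rewrite setI0 (_ : [set x in _ | _] = set0) ?cards0 //; apply/setP => x; rewrite !inE.
have [x xS] : exists x, x \in S by apply/card_gt0P; rewrite cS.
have [h hP] : exists h : V -> 'I_k1, k1 * Q (S :\ x) h
    <= \sum_i (#|U i :&: (S :\ x)| ^ 2 + k1 * #|U i :&: (S :\ x)|).
  by apply: IHm; move: cS; rewrite (cardsD1 x) xS => -[].
set S' := S :\ x in hP *.
pose g i b := #|[set y in U i :&: S' | h y == b]|.
pose G b := \sum_(i | x \in U i) g i b.
have gE i : \sum_b g i b = #|U i :&: S'|.
  rewrite -sum1_card (partition_big h predT) //=; apply: eq_bigr => b _.
  by rewrite sum1dep_card; apply: eq_card => y; rewrite !inE.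
have [b0 b0P] : exists b0, k1 * G b0 <= \sum_(i | x \in U i) #|U i :&: S'|.
  case: (@arg_minnP _ ord0 predT G isT) => b0 _ minb; exists b0.
  rewrite -(eq_bigr _ (fun i _ => gE i)) exchange_big /=.
  have -> : k1 * G b0 = \sum_(b < k1) G b0 by rewrite sum_nat_const card_ord.
  by apply: leq_sum => b _; apply: minb.
pose h' y := if y == x then b0 else h y.
have cE i b : #|[set y in U i :&: S | h' y == b]| = g i b + ((x \in U i) && (b == b0)).
  rewrite /g (cardsD1 x) addnC; congr (_ + _).
    apply: eq_card => y; rewrite !inE /h'; case: (y == x) => /=; last by [].
    by rewrite andbF.
  by rewrite !inE /h' eqxx xS andbT (eq_sym b).
have UE i : #|U i :&: S| = #|U i :&: S'| + (x \in U i).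
  rewrite (cardsD1 x) addnC !inE xS andbT; congr (_ + _).
  by apply: eq_card => y; rewrite !inE andbCA.
(* Adding [x] to a bucket of size [g] raises the square of its size by [2 * g + 1]. *)
have QE : Q S h' = Q S' h + (2 * G b0 + \sum_i (x \in U i)).
  rewrite -[Q S' h]/(\sum_i \sum_b g i b ^ 2) /Q /G [X in 2 * X]big_mkcond.
  rewrite big_distrr -!big_split /=; apply: eq_bigr => i _.
  rewrite (eq_bigr _ (fun b _ => congr1 (expn^~ 2) (cE i b))).
  rewrite (bigD1 b0) //= [in RHS](bigD1 b0) //= eqxx andbT.
  rewrite (eq_bigr (fun b => g i b ^ 2)); last first.
    by move=> b /negbTE->; rewrite andbF addn0.
  by rewrite -!mulnn; case: (x \in U i) => /=; nia.
exists h'; rewrite QE.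
have -> : \sum_i (#|U i :&: S| ^ 2 + k1 * #|U i :&: S|)
    = \sum_i (#|U i :&: S'| ^ 2 + k1 * #|U i :&: S'|)
    + (2 * \sum_(i | x \in U i) #|U i :&: S'| + (k1.+1) * \sum_i (x \in U i)).
  rewrite [X in 2 * X]big_mkcond !big_distrr -!big_split /=; apply: eq_bigr => i _.
  by rewrite UE -!mulnn; case: (x \in U i) => /=; nia.
nia.
Qed.

(* First fit decreasing: when row [i] is placed, at most
   [#|X i| * \sum_j #|X j| <= \sum_j #|X j| ^ 2] displacements are forbidden,
   where [j] ranges over the larger rows that were placed before. *)
Lemma row_displacement (I V : finType) (X : I -> {set V}) (col : V -> nat) :
  exists2 d : I -> nat, forall i, d i <= \sum_i #|X i| ^ 2
    & forall i j x y, x \in X i -> y \in X j ->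
        d i + col x = d j + col y -> i = j.
Proof.
suff H m (S : {set I}) : #|S| = m -> exists2 d : I -> nat,
    forall i, d i <= \sum_i #|X i| ^ 2
  & {in S &, forall i j x y, x \in X i -> y \in X j ->
      d i + col x = d j + col y -> i = j}.
  by have [d d1 d2] := H _ setT erefl; exists d => // i j; apply: d2.
elim: m S => [|m IHm] S cS.
  by exists (fun=> 0) => // i j; rewrite (card0_eq cS).
have [i1 i1S] : exists i, i \in S by apply/card_gt0P; rewrite cS.
case: (arg_minnP (fun i => #|X i|) i1S) => i0 i0S mini {i1 i1S}.
have {}i0S : i0 \in S by [].
have [d d1 d2] : exists2 d : I -> nat, forall i, d i <= \sum_i #|X i| ^ 2
    & {in S :\ i0 &, forall i j x y, x \in X i -> y \in X j ->
        d i + col x = d j + col y -> i = j}.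
  by apply: IHm; move: cS; rewrite (cardsD1 i0) i0S => -[].
(* A triple [(x, (j, y))] stands for the node [x] of the new row landing on the node [y] of row [j];
   it forbids one displacement. *)
pose F : {set V * (I * V)} :=
  setX (X i0) [set u : I * V | (u.1 \in S :\ i0) && (u.2 \in X u.1)].
have leF : #|F| <= \sum_i #|X i| ^ 2.
  rewrite cardsX -sum1dep_card.
  rewrite -(pair_big_dep (mem (S :\ i0)) (fun i x => x \in X i) (fun _ _ => 1)) /=.
  rewrite (eq_bigr (fun i => #|X i|)); last by move=> i _; rewrite sum1_card.
  rewrite big_distrr /= (bigID (mem (S :\ i0)) predT) /=.
  apply: leq_trans (leq_addr _ _); apply: leq_sum => i.
  rewrite !inE => /andP[_ iS]; rewrite -mulnn leq_mul2r; apply/orP; right; exact: mini.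
have [v vQ vF] := avoid_small_set (fun u => d u.2.1 + col u.2.2 - col u.1) leF.
have clash x j y : x \in X i0 -> j \in S -> j != i0 -> y \in X j ->
    v + col x <> d j + col y.
  move=> xX jS ji yX E; have := vF (x, (j, y)).
  by rewrite !inE /= xX ji jS yX -E addnK eqxx => /(_ isT).
exists (fun i => if i == i0 then v else d i) => [i|i j iS jS x y xX yX].
  by case: ifP.
have [ii|ii] := eqVneq i i0; have [jj|jj] := eqVneq j i0.
- by rewrite ii jj.
- by rewrite ii in xX; move/clash; case.
- by rewrite jj in yX; move/esym/clash; case.
- by apply: d2; rewrite ?inE ?ii ?jj.
Qed.

(** The rows are indexed by pairs [(s, b)]; the sum of their squared sizes, bounded by
    [balanced_buckets], bounds the displacements. *)
Lemma sparse_table (V : finType) (U : V -> {set V}) (col : V -> nat) k :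
  0 < k -> (forall s, #|U s| <= k) -> injective col ->
  exists (h : V -> nat) (d : V -> nat -> nat),
    [/\ forall t, h t < k, forall s b, d s b <= 2 * (k * #|V|)
      & forall s t s' t', t \in U s -> t' \in U s' ->
          d s (h t) + col t = d s' (h t') + col t' -> s = s' /\ t = t'].
Proof.
move=> k0 leU col_inj; have [h hQ] := balanced_buckets k0 leU.
pose X (u : V * 'I_k) := [set x in U u.1 | h x == u.2].
have [d d1 d2] := row_displacement X col.
have leQ : \sum_u #|X u| ^ 2 <= 2 * (k * #|V|).
  by move: hQ; rewrite pair_big_dep.
exists h, (fun s b => if insub b is Some b' then d (s, b') else 0); split=> //.
- by move=> s b; case: insub => // b'; apply: leq_trans (d1 _) leQ.
- move=> s t s' t' tU tU'; rewrite !valK => E.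
  have := d2 (s, h t) (s', h t') t t'; rewrite !inE tU tU' !eqxx.
  by case/(_ isT isT E)=> ss hh; move: E; rewrite ss hh => /addnI/col_inj.
Qed.

(** * Storage *)

Section MixedCut.

Variables (V : finType) (e : rel V) (A B : {set V}).
Hypothesis dAB : [disjoint A & B].

Definition cut_list : seq (V * V) :=
  [seq (x, x) | x <- enum (~: (A :|: B))] ++ enum (crossing e A B).

Definition mixed_cut : mixed V := [set decode a | a in cut_list].

Lemma mem_cut_list x y : ((x, y) \in cut_list) =
  (x == y) && (x \in ~: (A :|: B)) || [&& x \in A, y \in B & e x y].
Proof.
rewrite mem_cat mem_enum inE /=; congr (_ || _).
apply/mapP/andP => [[z + [-> ->]]|[/eqP<- xU]]; first by rewrite mem_enum.
by exists x; rewrite ?mem_enum.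
Qed.

Lemma size_cut_list : size cut_list = cut_size e A B.
Proof. by rewrite size_cat size_map -!cardE. Qed.

Lemma crossing_neq x y : x \in A -> y \in B -> x != y.
Proof. by move=> xA yB; apply/eqP => E; have := disjointFr dAB xA; rewrite E yB. Qed.

(** An edge has only one orientation from [A] to [B], so [decode] is injective on [cut_list]. *)
Lemma card_mixed_cut : #|mixed_cut| = size cut_list.
Proof.
have ul : uniq cut_list.
  rewrite cat_uniq map_inj_uniq ?enum_uniq /= ?andbT => [|x y []//].
  apply/hasPn => -[x y]; rewrite mem_enum inE /= => /and3P[xA yB _].
  by apply/mapP => -[z _ [xz yz]]; have := crossing_neq xA yB; rewrite xz yz eqxx.
rewrite -(card_uniqP ul); apply: card_in_imset => -[x y] [x' y'].
rewrite !mem_cut_list /decode /=.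
case/orP=> [/andP[/eqP<- _]|/and3P[xA yB _]];
  case/orP=> [/andP[/eqP<- _]|/and3P[xA' yB' _]]; rewrite ?eqxx.
- by case=> ->.
- by rewrite (negbTE (crossing_neq xA' yB')).
- by rewrite (negbTE (crossing_neq xA yB)).
rewrite (negbTE (crossing_neq xA' yB')) (negbTE (crossing_neq xA yB)) => -[/setP E].
have := E x; have := E y; rewrite !inE !eqxx orbT /=.
rewrite (negbTE (crossing_neq xA yB')) (eq_sym y) (negbTE (crossing_neq xA' yB)) /=.
by rewrite orbF => /esym/eqP-> /esym/eqP->.
Qed.

(** A walk that avoids the cut can never leave [A]. *)
Lemma mixed_cut_separates s t : s \in A -> t \in B -> st_cut e s t mixed_cut.
Proof.
move=> sA tB.
have inlC z : (inl z \in mixed_cut) = (z \notin A :|: B).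
  apply/imsetP/idP => [[[x y]]|zU]; last first.
    by exists (z, z); rewrite ?mem_cut_list /decode /= ?eqxx ?inE // -in_setU zU.
  rewrite mem_cut_list /decode /= => /orP[/andP[/eqP<- xU]|/and3P[xA yB _]].
    by rewrite eqxx => -[->]; rewrite -in_setC.
  by rewrite (negbTE (crossing_neq xA yB)).
apply/and4P; split.
- apply/forallP => f; apply/implyP => /imsetP[[x y]].
  rewrite mem_cut_list /decode /= => /orP[/andP[/eqP<- _]|/and3P[xA yB exy]].
    by rewrite eqxx.
  rewrite (negbTE (crossing_neq xA yB)) => -[->]; rewrite inE.
  by apply/existsP; exists x; apply/existsP; exists y; rewrite exy eqxx.
- by rewrite inlC negbK inE sA.
- by rewrite inlC negbK inE tB orbT.
apply/negP => /connectP[p pC tE].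
suff : t \in A by move=> tA; have := crossing_neq tA tB; rewrite eqxx.
rewrite tE; elim: p s sA pC {tE} => //= y p IHp x xA /andP[/and4P[exy _]].
rewrite inlC negbK inE => /orP[yA _|yB]; first exact: IHp.
case/negP; apply/imsetP; exists (x, y); first by rewrite mem_cut_list xA yB exy orbT.
by rewrite /decode /= (negbTE (crossing_neq xA yB)).
Qed.

End MixedCut.

(** * Memory layout and evaluation of the queries *)

Lemma prefix_flatten (T : eqType) (bs : seq (seq T)) i :
  prefix (nth [::] bs i) (drop (size (flatten (take i bs))) (flatten bs)).
Proof.
elim: bs i => [|b bs IH] [|i] //=; first by rewrite drop0 prefix_prefix.
by rewrite size_cat drop_cat ltnNge leq_addr /= addKn.
Qed.

(** Storing array [r] at the addresses congruent to [r] modulo [q] makes every address computable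
    without knowing [n] or [k], on which the programs must not depend. *)
Definition interleave q (F : nat -> nat -> nat) (len : nat) : seq nat :=
  mkseq (fun a => F (a %% q) (a %/ q)) (q * len).

Lemma nth_interleave q F len M r a : r < q -> a < len ->
  nth 0 (interleave q F len ++ M) (a * q + r) = F r a.
Proof.
move=> rq al; have lt : a * q + r < q * len by nia.
rewrite nth_cat size_mkseq lt nth_mkseq // divnMDl ?(leq_trans _ rq) //.
by rewrite divn_small // addn0 modnMDl modn_small.
Qed.

Definition section r (x : expr) : expr :=
  Mem (Op Add (Op Mul x (Cst 10)) (Cst r)).

(** Truncated differences serve as tests: the product is positive iff [p] lies in the interval of
    [x], and the last summand iff the table entry [v] equals the key. *)
Definition outside (x y : expr) : expr :=
  let p := section 0 (Op Add (section 1 x) y) in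
  let v := section 7 (Op Add (section 6 (Op Add (section 5 x) (section 4 y))) y) in
  let key := Op Add (section 8 x) y in
  Op Add
    (Op Mul (Op Defs.Sub (Op Add p (Cst 1)) (section 2 x)) (Op Defs.Sub (section 3 x) p))
    (Op Defs.Sub (Cst 1) (Op Add (Op Defs.Sub v key) (Op Defs.Sub key v))).

Definition con_expr : expr :=
  Op Mul (outside (Arg false) (Arg true)) (outside (Arg true) (Arg false)).

(** [z] is 1 if the second node lies in the set [B] of the first and 0 otherwise; it selects one of
    the two stored addresses. *)
Definition cut_expr : expr :=
  let z := Op Defs.Sub (Cst 1) (outside (Arg false) (Arg true)) in
  Op Add (Op Mul z (section 9 (Arg false)))
         (Op Mul (Op Defs.Sub (Cst 1) z) (section 9 (Arg true))).

Section Layout.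

Variables (V : finType) (s0 : V) (k : nat).
Variables (A U : V -> {set V}) (c : V -> nat) (pos : nat -> V -> nat).
Variables (lo hi : V -> nat) (h : V -> nat) (d : V -> nat -> nat).
Variables (addr : V -> nat) (tail : seq nat).

Variable n : nat.
Hypothesis nE : n = #|V|.
Let idx (s : V) : nat := enum_rank s.
Let node i : V := nth s0 (enum V) i.

Hypothesis k_gt0 : 0 < k.
Hypothesis c_le : forall s, c s <= 2 * k.
Hypothesis A_interval : forall s t, (t \in A s) = (lo s <= pos (c s) t < hi s).
Hypothesis h_lt : forall t, h t < k.
Hypothesis d_le : forall s b, d s b <= 2 * (k * n).
Hypothesis d_inj : forall s t s' t', t \in U s -> t' \in U s' ->
  d s (h t) + idx t = d s' (h t') + idx t' -> s = s' /\ t = t'.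

Let node_idx s : node (idx s) = s. Proof. exact: nth_enum_rank. Qed.
Let idx_lt s : idx s < n. Proof. rewrite nE; exact: ltn_ord. Qed.

Definition key s t := idx s * n + 1 + idx t.

(* The entry at address [a] is the key of the only pair displaced to [a]; [0]
   is not a key. *)
Definition table a :=
  if [pick u : V * V | (u.2 \in U u.1) && (d u.1 (h u.2) + idx u.2 == a)] is Some u
  then key u.1 u.2 else 0.

Lemma key_inj s t s' t' : key s t = key s' t' -> s = s' /\ t = t'.
Proof.
rewrite /key => E; have := idx_lt t; have := idx_lt t' => lt' lt.
have Es : idx s = idx s' by nia.
by split; apply/enum_rank_inj/val_inj; rewrite -?[val _]/(idx _); lia.
Qed.

(** If [t] is not in [U s], the entry found is 0 or the key of another pair, so a single comparison
    decides membership. *)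
Lemma tableE s t : (table (d s (h t) + idx t) == key s t) = (t \in U s).
Proof.
rewrite /table; case: pickP => [[s' t'] /= /andP[tU' /eqP E]|noU].
  apply/eqP/idP => [/key_inj[<- <-] //|tU].
  by have [-> ->] := d_inj tU' tU E.
rewrite /key addn1; have := noU (s, t); rewrite /= eqxx andbT => ->.
by apply/negbTE; rewrite eq_sym -lt0n; lia.
Qed.

Definition sections r a : nat :=
  match r with
  | 0 => pos (a %/ n) (node (a %% n))
  | 1 => c (node a) * n
  | 2 => lo (node a)
  | 3 => hi (node a)
  | 4 => h (node a)
  | 5 => a * k
  | 6 => d (node (a %/ k)) (a %% k)
  | 7 => table a
  | 8 => a * n + 1
  | _ => addr (node a)
  end.

(** The longest sections are the [2 * k + 1] orders of [n] nodes and the table with addresses below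
    [2 * (k * n) + n]; both fit into [3 * (k * n)]. *)
Definition memory : seq nat := interleave 10 sections (3 * (k * n)) ++ tail.

Lemma eval_section r x i j :
  r < 10 -> eval memory i j x < 3 * (k * n) ->
  eval memory i j (section r x) = sections r (eval memory i j x).
Proof. exact: nth_interleave. Qed.

Let n_le : n <= k * n. Proof. exact: leq_pmull. Qed.

Lemma idx_small s : idx s < 3 * (k * n).
Proof. have := idx_lt s; lia. Qed.

Lemma eval_outside i j x y s t :
  eval memory i j x = idx s -> eval memory i j y = idx t ->
  (0 < eval memory i j (outside x y)) = (t \in A s) || (t \in U s).
Proof.
move=> xE yE.
have opE o a b : eval memory i j (Op o a b)
    = arith_fun o (eval memory i j a) (eval memory i j b) by [].
have sec r z u : r < 10 -> eval memory i j z = idx u ->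
    eval memory i j (section r z) = sections r (idx u).
  move=> r10 zE; have zlt : eval memory i j z < 3 * (k * n) by rewrite zE idx_small.
  by rewrite (eval_section r10 zlt) zE.
have posE : eval memory i j (section 0 (Op Add (section 1 x) y)) = pos (c s) t.
  have E : eval memory i j (Op Add (section 1 x) y) = c s * n + idx t.
    by rewrite opE (sec _ _ s) // yE /= node_idx.
  have lt := idx_lt t; rewrite eval_section ?E //=; last first.
    by have := leq_mul (c_le s) (leqnn n); lia.
  by rewrite divnMDl ?(leq_trans _ lt) // divn_small // addn0 modnMDl modn_small // node_idx.
have tabE : eval memory i j
    (section 7 (Op Add (section 6 (Op Add (section 5 x) (section 4 y))) y))
    = table (d s (h t) + idx t).
  have E1 : eval memory i j (Op Add (section 5 x) (section 4 y)) = idx s * k + h t.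
    by rewrite opE (sec _ _ s) // (sec _ _ t) //= node_idx.
  have ht := h_lt t; have si := idx_lt s; have ti := idx_lt t.
  have E : eval memory i j (Op Add (section 6 (Op Add (section 5 x) (section 4 y))) y)
      = d s (h t) + idx t.
    rewrite opE eval_section ?E1 //=; last first.
      by have := leq_mul si (leqnn k); lia.
    by rewrite divnMDl // divn_small // addn0 modnMDl modn_small // node_idx yE.
  by rewrite eval_section ?E //=; have := d_le s (h t); lia.
have keyE : eval memory i j (Op Add (section 8 x) y) = key s t.
  by rewrite opE (sec _ _ s) // yE.
have loE : eval memory i j (section 2 x) = lo s by rewrite (sec _ _ s) //= node_idx.
have hiE : eval memory i j (section 3 x) = hi s by rewrite (sec _ _ s) //= node_idx.
have -> : eval memory i j (outside x y)
    = (pos (c s) t + 1 - lo s) * (hi s - pos (c s) t)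
    + (1 - ((table (d s (h t) + idx t) - key s t)
            + (key s t - table (d s (h t) + idx t)))).
  by rewrite -posE -tabE -keyE -loE -hiE.
rewrite A_interval -tableE addn_gt0 muln_gt0 !subn_gt0; congr (_ || _).
  by congr (_ && _); lia.
by lia.
Qed.

(** The cubic order comes from sections 5 and 8, which multiply an index below [3 * (k * n)] by [k]
    or [n]. *)
Lemma sections_le r a : k <= n ->
  (forall j v, pos j v <= n) -> (forall s, lo s <= n) -> (forall s, hi s <= n) ->
  (forall s, addr s <= 33 * (k * n)) -> a < 3 * (k * n) ->
  sections r a <= 33 * (n * n * n).
Proof.
move=> kn pos_le lo_le hi_le addr_le alt.
have n0 : 0 < n by apply: leq_trans kn.
have kn2 : k * n <= n * n by rewrite leq_mul.
have n1 : n <= n * n by rewrite leq_pmull.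
have n2 : n * n <= n * n * n by rewrite leq_pmulr.
have n3 : a * n <= 3 * (n * n * n).
  by rewrite (leq_trans (leq_mul (ltnW alt) (leqnn n))) // -mulnA leq_mul // leq_mul.
case: r => [|[|[|[|[|[|[|[|[|r]]]]]]]]] /=.
- by have := pos_le (a %/ n) (node (a %% n)); lia.
- by have := leq_mul (c_le (node a)) (leqnn n); lia.
- by have := lo_le (node a); lia.
- by have := hi_le (node a); lia.
- by have := h_lt (node a); lia.
- by have := leq_mul (leqnn a) kn; lia.
- by have := d_le (node (a %/ k)) (a %% k); lia.
- rewrite /table; case: pickP => // -[s t] _; rewrite /key /=.
  by have := leq_mul (ltnW (idx_lt s)) (leqnn n); have := idx_lt t; lia.
- lia.
- by have := addr_le (node a); lia.
Qed.

End Layout.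

(** * Assembly of the oracle *)

Lemma size_flatten_pairs (T T' : Type) (f g : T -> T') (l : seq T) :
  size (flatten [seq [:: f a; g a] | a <- l]) = 2 * size l.
Proof. by elim: l => //= a l ->; rewrite mulnS. Qed.

(** The edges at [s] form a cut with at most [#|V|] elements. *)
Lemma k_connected_small (V : finType) (e : rel V) k (s t : V) :
  k_connected e k -> s != t -> k <= #|V|.
Proof.
move=> conn st; apply: leq_trans (conn s t st) _.
have := @kappa_le_cut_size V e s t [set s] (~: [set s]).
rewrite disjoints_subset setCK subxx !inE eqxx eq_sym st => /(_ isT isT isT).
move/leq_trans; apply; rewrite /cut_size setUCr setCT cards0 add0n.
apply: leq_trans (leq_imset_card (pair s) V); apply: subset_leq_card.
apply/subsetP => -[x y]; rewrite inE /= => /and3P[/set1P-> _ _].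
by apply/imsetP; exists y.
Qed.

Lemma st_cut_sym (V : finType) (e : rel V) (s t : V) C :
  symmetric e -> st_cut e s t C -> st_cut e t s C.
Proof.
move=> esym /and4P[Ce sC tC stC]; apply/and4P; split=> //.
rewrite sym_connect_sym // => x y; rewrite /delete esym setUC.
by rewrite (andbCA (inl x \notin C)).
Qed.

Definition query_time := maxn (size (program_of con_expr)) (size (program_of cut_expr)).

Lemma oracle_exists (V : finType) (e : rel V) k :
  1 <= k -> symmetric e -> k_connected e k -> 1 < #|V| ->
  exists (M : seq nat) (L : seq (nat * mixed V)),
    [/\ size M <= 33 * (k * #|V|), all (fun x => x < #|V|.+1 ^ 7) M, size L <= #|V|
      & cut_oracle e k (program_of con_expr) (program_of cut_expr) query_time M L].
Proof.
move=> k0 esym conn n1; have /card_gt1P[s0 [t0 [_ _ st0]]] := n1.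
have kn := k_connected_small conn st0.
have [A [B [AB cut_le kappaE lam]]] := least_cuts esym conn.
pose U s := ~: (A s :|: B s).
have U_le s : #|U s| <= k by apply: leq_trans (leq_addr _ _) (cut_le s).
have [c [pos [lo [hi [c_le pos_le lo_le hi_le A_int]]]]] := region_intervals U_le lam.
pose idx (s : V) : nat := enum_rank s.
have idx_inj : injective idx by move=> s t /val_inj/enum_rank_inj.
have [h [d [h_lt d_le d_inj]]] := sparse_table k0 U_le idx_inj.
pose l s := cut_list e (A s) (B s).
pose block s := size (l s) :: flatten [seq [:: idx a.1; idx a.2] | a <- l s].
pose blocks := [seq block s | s <- enum V].
pose addr s := 10 * (3 * (k * #|V|)) + size (flatten (take (idx s) blocks)).
pose n := #|V|; have nE : n = #|V| by [].
pose M := memory s0 k U c pos lo hi h d addr (flatten blocks) n.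
pose C s := mixed_cut e (A s) (B s).
(* Listed cuts must separate some pair, so nodes with empty [B s] are left out. *)
exists M, [seq (addr s, C s) | s <- enum V & B s != set0].
have l_le s : size (l s) <= k by rewrite size_cut_list.
(* A block has at most [1 + 2 * k <= 3 * k] words; with the ten sections this gives the constant
   33. *)
have tail_le : size (flatten blocks) <= 3 * (k * n).
  rewrite size_flatten /shape -map_comp sumnE big_map big_enum /=.
  apply: leq_trans (_ : \sum_(s : V) 3 * k <= _).
    by apply: leq_sum => s _; rewrite /= size_flatten_pairs; have := l_le s; lia.
  by rewrite sum_nat_const -[#|_|]/n; lia.
have sizeM : size M = 30 * (k * n) + size (flatten blocks).
  by rewrite size_cat size_mkseq; lia.
have addr_le s : addr s <= 33 * (k * n).
  apply: leq_trans (_ : 10 * (3 * (k * n)) + size (flatten blocks) <= _); last lia.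
  rewrite leq_add2l -{2}(cat_take_drop (idx s) blocks) flatten_cat size_cat.
  exact: leq_addr.
have stored s : stored_at M (addr s) (C s).
  exists (l s); split=> //; first by rewrite card_mixed_cut //; case: (AB s).
  have := prefix_flatten blocks (idx s).
  rewrite (nth_map s0) -?cardE ?ltn_ord // nth_enum_rank.
  rewrite /M /memory /addr drop_cat size_mkseq -/n ltnNge leq_addr /=.
  by rewrite addKn.
have evM r (b : bool) s t : r < 10 ->
    eval M (idx s) (idx t) (section r (Arg b))
    = sections s0 k U c pos lo hi h d addr n r (idx (if b then t else s)).
  move=> r10; rewrite eval_section //=; first by case: b.
  by case: b; apply: idx_small.
have out b s t : 0 < eval M (idx s) (idx t) (outside (Arg b) (Arg (~~ b)))
    = ((if b then s else t) \notin B (if b then t else s)).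
  set u := if b then t else s; set v := if b then s else t.
  rewrite (@eval_outside _ s0 _ A U _ _ _ _ _ _ _ _ _ _ _
    c_le A_int h_lt d_le d_inj _ _ _ _ u v) //; last 2 first.
  - by rewrite /u => {u v}; case: b.
  - by rewrite /v => {u v}; case: b.
  have [_ dAB] := AB u; rewrite !inE negb_or.
  by case: (boolP (v \in A u)) => // vA; rewrite (disjointFr dAB vA).
split.
- by rewrite sizeM -/n; lia.
(* Since [n >= 2], four of the seven factors already give [81 > 33]. *)
- have W : 33 * (n * n * n) < n.+1 ^ 7.
    have h1 : 81 <= n.+1 ^ 4 by rewrite -[81]/(3 ^ 4) leq_exp2r.
    have h2 : n * n * n < n.+1 ^ 3 by rewrite -mulnA -[_ * _]/(n ^ 3) ltn_exp2r.
    by rewrite (expnD _ 4 3) (leq_trans _ (leq_mul h1 (leqnn _))) //; lia.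
  rewrite all_cat; apply/andP; split; apply/allP => x.
    case/mapP=> a; rewrite mem_iota /= add0n => alt ->; apply: leq_ltn_trans W.
    by apply: (@sections_le V) => //; rewrite ltn_divLR // mulnC.
  move=> /flattenP[b /mapP[s _ ->]] xb; apply: (@leq_ltn_trans n).
    move: xb; rewrite inE => /orP[/eqP->|]; first exact: leq_trans (l_le s) kn.
    case/flattenP=> _ /mapP[a _ ->]; rewrite !inE.
    by case/orP => /eqP->; apply/ltnW/ltn_ord.
  have : n.+1 ^ 1 <= n.+1 ^ 7 by rewrite leq_exp2l // ltnS ltnW.
  by rewrite expn1.
- by rewrite size_map size_filter (leq_trans (count_size _ _)) // -cardE.
split.
  move=> a /mapP[s]; rewrite mem_filter => /andP[/set0Pn[t tB] _] ->; split=> //=.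
  have [sA dAB] := AB s; exists s, t; split; first exact: (crossing_neq dAB).
  exact: mixed_cut_separates.
move=> s t st; split.
  exists (eval M (idx s) (idx t) con_expr).
    by apply: program_of_returns; apply: leq_maxl.
  have -> : eval M (idx s) (idx t) con_expr
      = eval M (idx s) (idx t) (outside (Arg false) (Arg true))
        * eval M (idx s) (idx t) (outside (Arg true) (Arg false)) by [].
  rewrite ltnNge kappaE // negb_or -(out false) -(out true) -muln_gt0 lt0n.
  by split=> /eqP.
exists (eval M (idx s) (idx t) cut_expr).
  by apply: program_of_returns; apply: leq_maxr.
rewrite kappaE // => tB.
have -> : eval M (idx s) (idx t) cut_expr
    = if t \in B s then addr s else addr t.
  have -> : eval M (idx s) (idx t) cut_expr
      = (1 - eval M (idx s) (idx t) (outside (Arg false) (Arg true)))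
        * eval M (idx s) (idx t) (section 9 (Arg false))
      + (1 - (1 - eval M (idx s) (idx t) (outside (Arg false) (Arg true))))
        * eval M (idx s) (idx t) (section 9 (Arg true)) by [].
  have := out false s t; rewrite -[~~ false]/true; cbv iota.
  move: (eval _ _ _ (outside _ _)) => o; rewrite !evM //= !nth_enum_rank.
  by case: o => [|o]; case: (t \in B s) => //= _; lia.
have inL u v : v \in B u ->
    (addr u, C u) \in [seq (addr s, C s) | s <- enum V & B s != set0].
  move=> vB; apply/mapP; exists u => //; rewrite mem_filter mem_enum andbT.
  by apply/set0Pn; exists v.
have C_le u : #|C u| <= k.
  by rewrite card_mixed_cut; [apply: l_le | case: (AB u)].
have [tBs|tBs] := boolP (t \in B s).
  by exists (C s); split=> //; [apply: inL tBs | apply: mixed_cut_separates; case: (AB s)].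
have sBt : s \in B t by move: tB; rewrite (negbTE tBs).
exists (C t); split=> //; first exact: inL sBt.
apply: st_cut_sym => //; apply: mixed_cut_separates => //; by case: (AB t).
Qed.

Theorem theorem1 :
  exists (space ncuts time wordexp : nat) (Pcon Pcut : program),
  forall (k : nat) (V : finType) (e : rel V),
    1 <= k -> symmetric e -> irreflexive e -> k_connected e k ->
    exists (M : seq nat) (L : seq (nat * mixed V)),
      [/\ size M <= space * (k * #|V|),
          all (fun x => x < #|V|.+1 ^ wordexp) M,
          size L <= ncuts * #|V|
        & cut_oracle e k Pcon Pcut time M L].
Proof.
exists 33, 1, query_time, 7, (program_of con_expr), (program_of cut_expr).
move=> k V e k0 esym _ conn; have [/card_le1_eqP le1|n1] := leqP #|V| 1.
  (* With at most one node there is no pair to query. *)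
  by exists [::], [::]; split=> //; split=> // s t; rewrite (le1 s t) ?eqxx.
by have [M [L]] := oracle_exists k0 esym conn n1; exists M, L; rewrite mul1n.
Qed.
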